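(* For every irrational real $\alpha$ we have $\sup_{k\geq 0}B(2^k\alpha)\geq 5$.
   Context: For an irrational real $x=[a_0;a_1,a_2,\ldots]$ (simple continued fraction), $B(x)=\limsup_{n\to\infty}a_n(x)$, where $a_n(x)$ is the $n$-th partial quotient. *)

(* Defs.v *)
From HB Require Import structures.
From mathcomp Require Import all_boot all_order all_algebra.
From mathcomp Require Import all_classical all_reals all_analysis.

Set Implicit Arguments.
Unset Strict Implicit.
Unset Printing Implicit Defensive.

Import Order.TTheory GRing.Theory Num.Theory.
Import numFieldNormedType.Exports.

Local Open Scope classical_set_scope.
Local Open Scope ring_scope.

(* [cf_complete x n] is the complete quotient x_n of the simple continued
   fraction algorithm: x = [a_0; ..., a_{n-1}, x_n], with x_0 = x and
   x_{n+1} = 1 / (x_n - floor x_n).  For irrational x no denominator vanishes,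
   so the convention 0^-1 = 0 plays no role. *)
Fixpoint cf_complete (R : realType) (x : R) (n : nat) : R :=
  if n is m.+1 then
    (cf_complete x m - (Num.floor (cf_complete x m))%:~R)^-1
  else x.

Definition partial_quotient (R : realType) (x : R) (n : nat) : int :=
  Num.floor (cf_complete x n).

(* The limsup is taken in the extended reals, so that it is +oo exactly when
   the partial quotients are unbounded. *)
Definition B (R : realType) (x : R) : \bar R :=
  limn_esup (fun n => ((partial_quotient x n)%:~R)%:E).

(* Main.v *)
Require Import Defs.
From HB Require Import structures.
From mathcomp Require Import all_boot all_order all_algebra.
From mathcomp Require Import all_classical all_reals all_analysis.
From mathcomp Require Import zify ring lra.

Import Order.TTheory GRing.Theory Num.Theory.
Import numFieldNormedType.Exports.

Local Open Scope classical_set_scope.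
Local Open Scope ring_scope.

(** Expand a positive irrational as a word in R and L with the slow (Farey)
    continued fraction map: read R and replace [y] by [y - 1] if [y > 1], read L
    and replace [y] by [y / (1 - y)] if [y < 1].  The run lengths of the word are
    the partial quotients, and doubling acts on words by Raney's four-state
    transducer.

    If all [2^k alpha] eventually had partial quotients at most 4, then no run of
    length 5 would survive in the tails of [alpha, 2 alpha, ..., 2^5 alpha].  A
    finite search over the states of the five transducers shows that the word of
    [alpha] is then eventually periodic with partial quotients 1, 1, 3, so that
    [alpha] is a root of an integral quadratic form of discriminant 17.  The same
    applies to every [2^k alpha].  The form of an irrational is unique up to
    scaling, and comparing the forms of [alpha] and [2^k alpha] shows that [2^k]
    divides the leading coefficient of the form of [alpha] for all [k], which is
    absurd. *)

Set Implicit Arguments.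
Unset Strict Implicit.

(** * The doubling transducer *)

(* The letters R and L are [true] and [false].  The states are the matrices
   diag(2,1), diag(1,2), diag(2,1) * L and diag(1,2) * R; [tstep] encodes
   identities such as diag(2,1) * L * R = R * L * diag(1,2). *)
Inductive tstate := TA | TB | TAL | TBR.

Definition tstep (s : tstate) (c : bool) : tstate * seq bool :=
  match s, c with
  | TA, true => (TA, [:: true; true])
  | TA, false => (TAL, [::])
  | TAL, false => (TA, [:: false])
  | TAL, true => (TB, [:: true; false])
  | TB, false => (TB, [:: false; false])
  | TB, true => (TBR, [::])
  | TBR, true => (TB, [:: true])
  | TBR, false => (TA, [:: false; true])
  end.

Fixpoint trun (s : tstate) (w : seq bool) : tstate * seq bool :=
  if w is c :: w' then
    let: (s1, o1) := tstep s c in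
    let: (s2, o2) := trun s1 w' in (s2, o1 ++ o2)
  else (s, [::]).

(* The product [t * s] of the two matrices is not divisible by 2; otherwise the
   second doubling would undo the first one. *)
Definition nobacktrack (s t : tstate) : bool :=
  match s, t with
  | TA, TB | TAL, TB | TB, TA | TBR, TA => false
  | _, _ => true
  end.

(* Words are accumulated in reverse order, so this inspects the last five
   letters. *)
Definition run5 (rw : seq bool) : bool :=
  if rw is [:: a, b, c, d, e & _] then [&& a == b, b == c, c == d & d == e]
  else false.

Arguments run5 _ : simpl never.

Fixpoint push (w rw : seq bool) : option (seq bool) :=
  if w is c :: w' then if run5 (c :: rw) then None else push w' (c :: rw)
  else Some rw.

Fixpoint feed (w : seq bool) (ls : seq (tstate * seq bool)) :
    option (seq (tstate * seq bool)) :=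
  if ls is (s, rw) :: ls' then
    let: (s', o) := trun s w in
    if push o rw is Some rw' then
      if feed o ls' is Some ls'' then Some ((s', rw') :: ls'') else None
    else None
  else Some [::].

(* One period of the expansion [1; 1, 3, 1, 1, 3, ...] of the positive root of
   [2 y^2 - 3 y - 1]. *)
Definition period17 : seq bool :=
  [:: true; false; true; true; true; false; true; false; false; false].

(** The first clause supplies a starting point for the period; the second carries an occurrence to
    the next one, so windows along an orbit chain into full periodicity. *)
Definition periodic_window (v : seq bool) : bool :=
  has (fun i => take 10 (drop i v) == period17) (iota 0 10) &&
  ((take 10 v == period17) ==> (take 10 (drop 10 v) == period17)).

(* The first three letters are discarded because the runs preceding the starting
   point are unknown. *)
Fixpoint search (n : nat) (rw : seq bool) (ls : seq (tstate * seq bool)) : bool :=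
  if n is n'.+1 then
    all (fun c =>
      if push [:: c] rw is Some rw' then
        if feed [:: c] ls is Some ls' then search n' rw' ls' else true
      else true) [:: true; false]
  else periodic_window (drop 3 (rev rw)).

Fixpoint all_paths (k : nat) (ok : pred tstate) (P : pred (seq tstate)) : bool :=
  if k is k'.+1 then
    all (fun s => if ok s then all_paths k' (nobacktrack s) (fun ss => P (s :: ss))
                  else true) [:: TA; TB; TAL; TBR]
  else P [::].

Definition init_levels (ss : seq tstate) : seq (tstate * seq bool) :=
  [seq (s, [::]) | s <- ss].

(** The depth 25 consists of the three discarded letters and a window of 22, which covers the 20
    letters inspected by [periodic_window]. *)
Lemma search_all_paths :
  all_paths 5 xpredT (fun ss => search 25 [::] (init_levels ss)).
Proof. by vm_compute. Qed.

Lemma trun_cat s v w :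
  trun s (v ++ w) = let: (s1, o1) := trun s v in
                    let: (s2, o2) := trun s1 w in (s2, o1 ++ o2).
Proof.
elim: v s => [|c v IH] s /=; first by case: trun.
case: tstep => s1 o1; rewrite IH; case: trun => s2 o2.
by case: trun => s3 o3; rewrite catA.
Qed.

Lemma size_trun s w : (size w <= (size (trun s w).2).*2.+1)%N.
Proof.
(* The states [TAL] and [TBR] hold one letter that has been read but not yet emitted. *)
pose pending s := if s is (TAL | TBR) then 1%N else 0%N.
suff : (size w + pending s <=
        (size (trun s w).2).*2 + pending (trun s w).1)%N.
  by case: (trun s w) => -[] o /=; lia.
elim: w s => [|c w IH] s //=.
case E: (tstep s c) => [s1 o1]; have := IH s1.
case: trun => s2 o2 /=; rewrite size_cat.
by case: s c E => [] [] [<- <-] /=; lia.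
Qed.

Fixpoint states (k : nat) (w : seq bool) : seq tstate :=
  if k is k'.+1 then let: (s, o) := trun TA w in s :: states k' o else [::].

(** A step multiplies the product of the two state matrices by unimodular matrices only, so
    divisibility by 2 is unaffected. *)
Lemma nobacktrack_trun s t w : nobacktrack s t ->
  nobacktrack (trun s w).1 (trun t (trun s w).2).1.
Proof.
elim: w s t => [|c w IH] s t //= st.
have := IH (tstep s c).1 (trun t (tstep s c).2).1.
case E: (tstep s c) => [s1 o1] /= /(_ _).
case E2: (trun s1 w) => [s2 o2] /=.
rewrite trun_cat; case E3: (trun t o1) => [t1 p1] /=.
case: trun => t2 p2 /=; apply.
by case: s c t st E E3 => [] [] [] // _ [<- <-] [<- _].
Qed.

Lemma all_paths_states k ok P w : all_paths k ok P ->
  ok (trun TA w).1 -> P (states k w).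
Proof.
elim: k ok P w => [|k IH] ok P w //=.
have := @nobacktrack_trun TA TA w erefl; case: trun => s o /= so + oks.
have P' : all_paths k (nobacktrack s) (fun ss => P (s :: ss)) -> P (s :: states k o).
  by move=> /IH; apply.
move=> /and5P[hA hB hC hD _]; apply: P' => {so}.
by case: s oks => oks; move: hA hB hC hD; rewrite oks.
Qed.

(** * The Farey map *)

Section Rationality.
Variable R : realType.
Implicit Types x y : R.

Lemma rational_int (m : int) : rational (m%:~R : R).
Proof. by exists m%:~R => //; rewrite ratr_int. Qed.

Lemma rationalD x y : rational x -> rational y -> rational (x + y).
Proof. by move=> [p _ <-] [q _ <-]; exists (p + q) => //; rewrite rmorphD. Qed.

Lemma rationalM x y : rational x -> rational y -> rational (x * y).
Proof. by move=> [p _ <-] [q _ <-]; exists (p * q) => //; rewrite rmorphM. Qed.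

Lemma rationalV x : rational x -> rational x^-1.
Proof. by move=> [p _ <-]; exists p^-1 => //; rewrite fmorphV. Qed.

Lemma irrationalDint x (m : int) : irrational x -> irrational (x + m%:~R).
Proof.
move=> xirr xm; apply: xirr.
rewrite -(addrK m%:~R x) -rmorphN.
exact: rationalD xm (rational_int _).
Qed.

Lemma irrationalV x : irrational x -> irrational x^-1.
Proof. by move=> xirr /rationalV; rewrite invrK. Qed.

Lemma irrationalMint x (m : int) :
  m != 0 -> irrational x -> irrational (m%:~R * x).
Proof.
move=> m0 xirr mx; apply: xirr.
have -> : x = m%:~R^-1 * (m%:~R * x) by rewrite mulKf ?intr_eq0.
apply: rationalM mx; exact/rationalV/rational_int.
Qed.

Lemma irrational_neq_int x (m : int) : irrational x -> x != m%:~R.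
Proof. by move=> xirr; apply/eqP => xm; apply: xirr; rewrite xm; exact: rational_int. Qed.

End Rationality.

Section Farey.
Variable R : realType.
Implicit Types y z : R.

Definition farey y : R := if 1 < y then y - 1 else y / (1 - y).

Fixpoint fword (n : nat) y : seq bool :=
  if n is n'.+1 then (1 < y) :: fword n' (farey y) else [::].

Definition posirr y := 0 < y /\ irrational y.

Variant farey_spec y : bool -> R -> Prop :=
  | FareyR of 1 < y : farey_spec y true (y - 1)
  | FareyL of y < 1 : farey_spec y false (y / (1 - y)).

Lemma fareyP y : posirr y -> farey_spec y (1 < y) (farey y).
Proof.
move=> [_ yirr]; rewrite /farey; case: (ltgtP y 1) => y1; try by constructor.
by have := irrational_neq_int 1 yirr; rewrite y1 eqxx.
Qed.

Lemma farey_posirr y : posirr y -> posirr (farey y).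
Proof.
move=> py; have [y0 yirr] := py.
case: (fareyP py) => y1; split.
- lra.
- by have -> : y - 1 = y + (-1)%:~R; [rewrite rmorphN1|exact: irrationalDint].
- by apply: divr_gt0 => //; lra.
- have -> : y / (1 - y) = (y^-1 + (-1)%:~R)^-1.
    rewrite rmorphN1 (_ : y^-1 - 1 = (1 - y) / y) ?invf_div//.
    by rewrite mulrBl mul1r divff ?gt_eqF.
  exact/irrationalV/irrationalDint/irrationalV.
Qed.

Lemma iter_farey_posirr n y : posirr y -> posirr (iter n farey y).
Proof. by move=> py; elim: n => //= n; exact: farey_posirr. Qed.

Lemma size_fword n y : size (fword n y) = n.
Proof. by elim: n y => //= n IH y; rewrite IH. Qed.

Lemma fwordD m n y : fword (m + n) y = fword m y ++ fword n (iter m farey y).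
Proof. by elim: m y => //= m IH y; rewrite IH -iterSr. Qed.

Lemma fwordSr n y : fword n.+1 y = rcons (fword n y) (1 < iter n farey y).
Proof. by rewrite -addn1 fwordD cats1. Qed.

Definition bounded_orbit y :=
  posirr y /\ forall i, 5^-1 < iter i farey y < 5.

Lemma bounded_orbit_iter n y : bounded_orbit y -> bounded_orbit (iter n farey y).
Proof.
by move=> [py yb]; split=> [|i]; [exact: iter_farey_posirr|rewrite -iterD].
Qed.

(** An L step lowers [y^-1] by 1. Chained in [run5_fword], this shows that five letters L force
    [y <= 5^-1]. *)
Lemma farey_le k y : posirr y -> y < 1 -> farey y * k <= 1 -> y * (k + 1) <= 1.
Proof.
move=> py; case: (fareyP py) => [|_] y1; first lra.
by rewrite mulrAC ler_pdivrMr; lra.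
Qed.

Lemma run5_fword y : posirr y -> 5^-1 < y < 5 -> run5 (rev (fword 5 y)) = false.
Proof.
move=> py yb; apply/negbTE/negP.
pose p i := iter_farey_posirr i py.
have /= p1 := p 1%N; have /= p2 := p 2%N; have /= p3 := p 3%N; have /= p4 := p 4%N.
rewrite /rev /run5 /= => /and4P[/eqP e4 /eqP e3 /eqP e2 /eqP e1].
case: (ltP 1 y) e1 => y1 e1.
  move: e1 e2 e3 e4; rewrite {p p1 p2 p3 p4}/farey y1.
  by repeat (case: ltP => //= ?); lra.
have lt1 z : posirr z -> (1 < z) = false -> z < 1.
  by move=> pz; case: (fareyP pz).
have l1 := lt1 _ p1 e1.
have {}e2 := etrans e2 e1; have l2 := lt1 _ p2 e2.
have {}e3 := etrans e3 e2; have l3 := lt1 _ p3 e3.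
have {}e4 := etrans e4 e3; have l4 := lt1 _ p4 e4.
have y1' : y < 1 by apply: lt1 => //; apply/negbTE; rewrite -leNgt.
have {l4} := ltW l4; rewrite -[leLHS]mulr1.
move=> /(farey_le p3 l3) /(farey_le p2 l2) /(farey_le p1 l1) /(farey_le py y1').
lra.
Qed.

Lemma push_fword n Y o : bounded_orbit Y ->
  o = fword (size o) (iter n farey Y) ->
  push o (rev (fword n Y)) = Some (rev (fword (n + size o) Y)).
Proof.
move=> bY; elim: o n => [|c o IH] n /=; first by rewrite addn0.
move=> [cE oE].
rewrite cE -rev_rcons -fwordSr.
have -> : run5 (rev (fword n.+1 Y)) = false.
  have [n4|n4] := ltnP n 4.
    by move: n n4 {IH cE oE}; do 4 (case=> //).
  have -> : n.+1 = (n - 4 + 5)%N by lia.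
  rewrite fwordD rev_cat.
  have [py /(_ 0%N) yb] := bounded_orbit_iter (n - 4) bY.
  have := run5_fword py yb.
  by move: (iter _ _ _) => z; rewrite /rev/run5/=.
by rewrite IH ?addSnnS//.
Qed.

(** The matrix of [s], acting as a Moebius map, sends the unread input tail [z] to the output tail
    [z']; denominators are cleared. *)
Definition trel (s : tstate) z z' : Prop :=
  match s with
  | TA => z' = 2 * z
  | TB => z = 2 * z'
  | TAL => z' * (1 + z) = 2 * z
  | TBR => 2 * z' = 1 + z
  end.

Lemma fareyR y : 1 < y -> farey y = y - 1.
Proof. by rewrite /farey => ->. Qed.

Lemma fareyL y : y <= 1 -> farey y = y / (1 - y).
Proof. by rewrite /farey ltNge => ->. Qed.

Lemma tstep_trel s z z' : posirr z -> posirr z' -> trel s z z' ->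
  let: (s', o) := tstep s (1 < z) in
  fword (size o) z' = o /\ trel s' (farey z) (iter (size o) farey z').
Proof.
move=> pz [z'0 _]; have [z0 _] := pz.
case: s => /= rel; case: (fareyP pz) => z1 /=.
- have a1 : 1 < z' by lra.
  by rewrite (fareyR a1) a1 (_ : (1 < z' - 1) = true) ?fareyR; try lra; split=> //; lra.
- by split=> //; rewrite rel; field; apply/eqP; lra.
- by split=> //; lra.
- have a1 : z' <= 1 by lra.
  rewrite (fareyL a1) ltNge a1 /=.
  have a2 : z' / (1 - z') <= 1 by rewrite ler_pdivrMr; lra.
  rewrite ltNge a2 (fareyL a2); split=> //.
  by rewrite rel; field; rewrite ?andbT; repeat (apply/andP; split); apply/eqP; lra.
- have zE : z' = 2 * z / (1 + z) by rewrite -rel mulfK ?gt_eqF//; lra.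
  have a1 : 1 < z' by rewrite zE ltr_pdivlMr; lra.
  have dE : z' - 1 = (z - 1) / (z + 1).
    by rewrite zE; field; repeat (apply/andP; split); apply/eqP; lra.
  have a2 : z' - 1 <= 1 by rewrite dE ler_pdivrMr; lra.
  rewrite a1 (fareyR a1) ltNge a2 (fareyL a2); split=> //.
  by rewrite dE; field; repeat (apply/andP; split); apply/eqP; lra.
- have zE : z' = 2 * z / (1 + z) by rewrite -rel mulfK ?gt_eqF//; lra.
  have a1 : z' <= 1 by rewrite zE ler_pdivrMr; lra.
  rewrite ltNge a1 (fareyL a1); split=> //.
  by rewrite zE; field; repeat (apply/andP; split); apply/eqP; lra.
- have a1 : 1 < z' by lra.
  by rewrite a1 fareyR//; split=> //; lra.
- have zE : z' = (1 + z) / 2 by lra.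
  have a1 : z' <= 1 by lra.
  have a2 : 1 < z' / (1 - z') by rewrite ltr_pdivlMr; lra.
  rewrite ltNge a1 (fareyL a1) a2 (fareyR a2); split=> //.
  by rewrite zE; field; repeat (apply/andP; split); apply/eqP; lra.
Qed.

Lemma trun_trel s n z z' : posirr z -> posirr z' -> trel s z z' ->
  let: (s', o) := trun s (fword n z) in
  fword (size o) z' = o /\ trel s' (iter n farey z) (iter (size o) farey z').
Proof.
elim: n s z z' => [|n IH] s z z' pz pz' rel //=.
have := tstep_trel pz pz' rel; case: tstep => s1 o1 [w1E rel1].
have := IH s1 _ _ (farey_posirr pz) (iter_farey_posirr (size o1) pz') rel1.
case: trun => s2 o2 [w2E rel2].
by rewrite size_cat fwordD w1E w2E -iterS iterSr addnC iterD.
Qed.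

(** [Y] is the tail at which recording began at this level. Its current iterate is both the output
    tail of the level and the input tail of the next one. *)
Fixpoint levels_ok z (ls : seq (tstate * seq bool)) : Prop :=
  if ls is (s, rw) :: ls' then
    exists Y n, [/\ bounded_orbit Y, rw = rev (fword n Y),
      trel s z (iter n farey Y) & levels_ok (iter n farey Y) ls']
  else True.

Lemma feed_levels_ok z n ls : posirr z -> levels_ok z ls ->
  exists2 ls', feed (fword n z) ls = Some ls' & levels_ok (iter n farey z) ls'.
Proof.
elim: ls z n => [|[s rw] ls IH] z n pz /=; first by exists [::].
move=> [Y [m [bY -> rel ok]]].
have pY := (bounded_orbit_iter m bY).1.
have := trun_trel n pz pY rel.
case: trun => s' o [wE rel'].
rewrite (push_fword bY (esym wE)).
have [ls' lsE ok'] := IH _ (size o) pY ok.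
rewrite wE in lsE; rewrite lsE; eexists; first by [].
move: rel' ok'; rewrite -!iterD => rel' ok'.
by exists Y, (m + size o)%N; rewrite addnC in rel' ok' *.
Qed.

(** Bounded orbits contain no run of five, so the branch followed by an actual orbit is never pruned
    and ends at a tested leaf. *)
Lemma search_fword n z m ls : bounded_orbit z ->
  levels_ok (iter m farey z) ls -> search n (rev (fword m z)) ls ->
  periodic_window (drop 3 (fword (m + n) z)).
Proof.
move=> bz; elim: n m ls => [|n IH] m ls ok /=; first by rewrite revK addn0.
have pz := (bounded_orbit_iter m bz).1.
have [ls' lsE ok'] := feed_levels_ok 1 pz ok.
rewrite /= in lsE.
have := push_fword (o := [:: 1 < iter m farey z]) bz erefl.
rewrite /= addn1 => pE.
have {}IH : search n (rev (fword m.+1 z)) ls' ->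
    periodic_window (drop 3 (fword (m + n.+1) z)).
  by rewrite addnS -addSn; exact: IH.
case: (1 < _) lsE pE => -> -> /and3P[h1 h2 _]; exact: IH.
Qed.

End Farey.

(** * Periodicity *)

Section Periodicity.
Variable R : realType.
Implicit Types x y z u : R.

Definition eventually_bounded y := exists N, bounded_orbit (iter N (@farey R) y).

Lemma posirr_double y : posirr y -> posirr (2 * y).
Proof. by move=> [y0 yirr]; split; [lra|exact: (@irrationalMint _ _ 2)]. Qed.

Lemma posirr_exp2 k y : posirr y -> posirr (2 ^+ k * y).
Proof.
by move=> py; elim: k => [|k /posirr_double]; rewrite ?mul1r// exprS mulrA.
Qed.

Lemma eventually_levels_ok k y : posirr y ->
  (forall j, (j < k)%N -> eventually_bounded (2 ^+ j.+1 * y)) ->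
  exists n0, forall n, (n0 <= n)%N ->
    levels_ok (iter n (@farey R) y) (init_levels (states k (fword n y))).
Proof.
elim: k y => [|k IH] y py ev; first by exists 0%N.
have [N bN] := ev 0%N isT; rewrite expr1 in bN.
have p2y := posirr_double py.
have [|n1 ok1] := IH (2 * y) p2y.
  by move=> j jk; rewrite mulrA -exprSr; exact: ev.
(* By [size_trun], this many input letters yield at least [N + n1] output letters. *)
exists (N + n1).*2.+1 => n nge /=.
have := @trun_trel R TA n _ _ py p2y erefl.
have := size_trun TA (fword n y); rewrite size_fword.
case: trun => s o /= nle [wE rel].
exists (iter (size o) (@farey R) (2 * y)), 0%N; split=> //.
- have -> : size o = ((size o - N) + N)%N by lia.
  by rewrite iterD; exact: bounded_orbit_iter.
- by rewrite -{2}wE; apply: ok1; lia.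
Qed.

Lemma eventually_periodic_window y : posirr y ->
  (forall j, (j <= 5)%N -> eventually_bounded (2 ^+ j * y)) ->
  exists n0, forall n, (n0 <= n)%N ->
    bounded_orbit (iter n (@farey R) y) /\
    periodic_window (fword 22 (iter n (@farey R) y)).
Proof.
move=> py ev.
have [n1 ok1] := eventually_levels_ok py (fun j jk => ev j.+1 jk).
have [N bN] := ev 0%N isT; rewrite mul1r in bN.
exists (N + n1 + 3)%N => n nge.
have bo m : (N <= m)%N -> bounded_orbit (iter m (@farey R) y).
  by move=> Nm; rewrite -(subnK Nm) iterD; exact: bounded_orbit_iter.
split; first by apply: bo; lia.
(* The search starts three letters earlier, since it discards its first three letters. *)
have -> : n = (3 + (n - 3))%N by lia.
rewrite iterD; set m := (n - 3)%N.
have bm : bounded_orbit (iter m (@farey R) y) by apply: bo; lia.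
have /ok1 okm : (n1 <= m)%N by lia.
have := all_paths_states (w := fword m y) search_all_paths isT.
by move=> /(search_fword (m := 0) bm okm).
Qed.

(* If [iter (size w) farey y = p / q] and [y] starts with [w], then
   [pullback w (p, q)] is a numerator-denominator pair of [y]. *)
Fixpoint pullback (w : seq bool) (pq : R * R) : R * R :=
  if w is c :: w' then
    let: (p, q) := pullback w' pq in if c then (p + q, q) else (p, p + q)
  else pq.

Lemma fword_pullback n y p q : posirr y -> iter n (@farey R) y * q = p ->
  y * (pullback (fword n y) (p, q)).2 = (pullback (fword n y) (p, q)).1.
Proof.
elim: n y => [//|n IH] y py; rewrite iterSr => /(IH _ (farey_posirr py)) /=.
case: pullback => a b /=; case: (fareyP py) => y1 /= <-; first by ring.
by field; apply/eqP; lra.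
Qed.

Lemma period17_moebius y : posirr y -> fword 10 y = period17 ->
  y * (32 * iter 10 (@farey R) y + 9) = 57 * iter 10 (@farey R) y + 16.
Proof.
move=> py w; have := fword_pullback py (mulr1 (iter 10 (@farey R) y)).
by rewrite w; move: (iter 10 _ _) => u /= h; lra.
Qed.

Definition form17 y : R := 2 * y ^+ 2 - 3 * y - 1.

(** The matrix of one period has determinant 1 and fixes the roots of [form17], so the form is
    multiplied by the square of the denominator [32 * u + 9], which exceeds 9 as [u > 0]. *)
Lemma period17_expand y : posirr y -> fword 10 y = period17 ->
  81 * `|form17 y| <= `|form17 (iter 10 (@farey R) y)|.
Proof.
move=> py w; have := period17_moebius py w.
have [u0 _] := iter_farey_posirr 10 py.
move: (iter 10 _ _) u0 => u u0 /= yE.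
have -> : form17 u = (32 * u + 9) ^+ 2 * form17 y.
  have -> : (32 * u + 9) ^+ 2 * form17 y =
    2 * (y * (32 * u + 9)) ^+ 2 - 3 * (y * (32 * u + 9)) * (32 * u + 9)
    - (32 * u + 9) ^+ 2 by rewrite /form17; ring.
  by rewrite yE /form17; ring.
rewrite normrM ger0_norm ?sqr_ge0// ler_wpM2r// expr2; nra.
Qed.

Lemma take_drop_fword i m n z : (i + m <= n)%N ->
  take m (drop i (fword n z)) = fword m (iter i (@farey R) z).
Proof.
move=> imn; have -> : n = (i + (m + (n - (i + m))))%N by lia.
rewrite !fwordD drop_size_cat ?size_fword// take_size_cat ?size_fword//.
Qed.

Lemma periodic_window_has z : periodic_window (fword 22 z) ->
  exists i, fword 10 (iter i (@farey R) z) = period17.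
Proof.
move=> /andP[/hasP[i]]; rewrite mem_iota add0n => /andP[_ i10] /eqP iE _.
by exists i; rewrite -iE take_drop_fword//; lia.
Qed.

Lemma periodic_window_next z : periodic_window (fword 22 z) ->
  fword 10 z = period17 -> fword 10 (iter 10 (@farey R) z) = period17.
Proof.
move=> /andP[_ /implyP h] zE; apply/eqP.
rewrite -(@take_drop_fword 10 10 22)//; apply: h; apply/eqP.
by have := @take_drop_fword 0 10 22 z isT; rewrite drop0 => ->.
Qed.

(** A nonzero value of [form17] would grow without bound along the periods, while the orbit stays in
    a bounded interval. *)
Lemma periodic_root y : bounded_orbit y -> fword 10 y = period17 ->
  (forall n, periodic_window (fword 22 (iter n (@farey R) y))) -> form17 y = 0.
Proof.
move=> [py yb] w per.
have w10 j : fword 10 (iter (10 * j) (@farey R) y) = period17.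
  elim: j => [//|j IH].
  by have := periodic_window_next (per _) IH; rewrite -iterD -mulnS.
(* The growth is geometric, but a linear lower bound suffices. *)
have grow j : j%:R * `|form17 y| <= `|form17 (iter (10 * j) (@farey R) y)|.
  elim: j => [|j IH]; first by rewrite mul0r.
  have := period17_expand (iter_farey_posirr _ py) (w10 j).
  rewrite -iterD -mulnS.
  case: j IH => [|j] IH h; first by rewrite mul1r; lra.
  apply: le_trans h; apply: le_trans (ler_wpM2l _ IH) => //.
  rewrite mulrA ler_wpM2r// -natr1 -[j.+1%:R]natr1.
  have := ler0n R j; lra.
apply/eqP/negPn/negP => fy0.
have f0 : 0 < `|form17 y| by rewrite normr_gt0.
have := grow (Num.truncn (100 / `|form17 y|)).+1.
have := truncnS_gt (100 / `|form17 y|); rewrite ltr_pdivrMr//.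
have := yb (10 * (Num.truncn (100 / `|form17 y|)).+1)%N.
move: (iter _ _ _) => z /andP[z1 z2] h1 h2.
have : `|form17 z| <= 100 by rewrite ler_norml /form17 expr2; apply/andP; split; nra.
lra.
Qed.

End Periodicity.

(** * Forms of discriminant 17 *)

Section Discriminant.
Variable R : realType.
Implicit Types x y : R.

Definition disc17 x := exists a b c : int,
  a%:~R * x ^+ 2 + b%:~R * x + c%:~R = 0 /\ b ^+ 2 - 4 * a * c = 17.

(** Both branches of the Farey map are unimodular substitutions, which preserve integrality and the
    discriminant. *)
Lemma disc17_farey y : posirr y -> disc17 (farey y) -> disc17 y.
Proof.
move=> py; case: (fareyP py) => y1 [a [b [c [rt disc]]]].
- exists a, (b - 2 * a), (a - b + c); split; last by rewrite -disc; ring.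
  by rewrite -rt !(rmorphD, rmorphN, rmorphM)/=; ring.
- exists (a - b + c), (b - 2 * c), c; split; last by rewrite -disc; ring.
  have y1' : 1 - y != 0 by apply/eqP; lra.
  rewrite -[RHS](mulr0 ((1 - y) ^+ 2)) -rt.
  by rewrite !(rmorphD, rmorphN, rmorphM)/=; field.
Qed.

Lemma disc17_iter n y : posirr y -> disc17 (iter n (@farey R) y) -> disc17 y.
Proof.
elim: n => [//|n IH] py /= /disc17_farey h.
exact/IH/h/iter_farey_posirr.
Qed.

Lemma irrational_linear x (m n : int) : irrational x ->
  m%:~R * x + n%:~R = 0 -> m = 0.
Proof.
move=> xirr mn; apply/eqP/negPn/negP => m0.
have := irrational_neq_int (- n) (irrationalMint m0 xirr).
by rewrite rmorphN -addr_eq0 mn eqxx.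
Qed.

Lemma not_disc17_doublings x : irrational x ->
  ~ (forall k, disc17 (2 ^+ k * x)).
Proof.
move=> xirr h.
have [a [b [c [rt disc]]]] := h 0%N; rewrite mul1r in rt.
(* Completing the square turns each form into a square root of 17. *)
have sq (p q r : int) (z : R) : p%:~R * z ^+ 2 + q%:~R * z + r%:~R = 0 ->
    q ^+ 2 - 4 * p * r = 17 -> (2 * p%:~R * z + q%:~R) ^+ 2 = 17.
  move=> rt' d'.
  have -> : (2 * p%:~R * z + q%:~R) ^+ 2 =
    4 * p%:~R * (p%:~R * z ^+ 2 + q%:~R * z + r%:~R) + (q ^+ 2 - 4 * p * r)%:~R.
    by rewrite !(rmorphD, rmorphN, rmorphM, rmorphXn)/=; ring.
  by rewrite rt' d'; ring.
(* The two square roots of 17, linear in [x], agree up to sign; irrationality of [x] then equates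
   their leading coefficients. *)
have dvd k : exists p : int, a = p * 2 ^+ k.
  have [p [q [r [rtk dk]]]] := h k.
  have /eqP := etrans (sq _ _ _ _ rt disc) (esym (sq _ _ _ _ rtk dk)).
  rewrite eqf_sqr => /orP[] /eqP e.
  - exists p; suff : 2 * (a - p * 2 ^+ k) = 0 by lia.
    apply: (@irrational_linear x _ (b - q) xirr).
    rewrite !(rmorphD, rmorphN, rmorphM, rmorphXn)/=; lra.
  - exists (- p); suff : 2 * (a + p * 2 ^+ k) = 0 by lia.
    apply: (@irrational_linear x _ (b + q) xirr).
    rewrite !(rmorphD, rmorphN, rmorphM, rmorphXn)/=; lra.
have a0 : a != 0.
  apply/eqP => a0; rewrite a0 mul0r add0r in rt.
  have b0 := irrational_linear xirr rt.
  by move: disc; rewrite a0 b0 mulr0 mul0r expr0n.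
(* The exponent [|a|] suffices because [|a| < 2 ^ |a|]. *)
have [p aE] := dvd `|a|%N.
have p0 : p != 0 by apply: contra_neq a0 => p0; rewrite aE p0 mul0r.
have := ltn_expl `|a|%N (isT : 1 < 2)%N; rewrite ltnNge => /negP; apply.
by rewrite {2}aE abszM abszX leq_pmull// absz_gt0.
Qed.

End Discriminant.

(** * Continued fractions *)

Section ContinuedFraction.
Variable R : realType.
Implicit Types x y c v : R.

(** The first floor absorbs [m]. This permits replacing [alpha] by its fractional part, as the Farey
    map needs a positive number. *)
Lemma cf_completeDint x (m : int) n :
  cf_complete (x + m%:~R) n.+1 = cf_complete x n.+1.
Proof.
elim: n => [|n IH]; last by rewrite [LHS]/= -/(cf_complete _ n.+1) IH.
rewrite /=; congr _^-1.
have -> : Num.floor (x + m%:~R) = Num.floor x + m.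
  apply: floor_def; have := floor_itv x; rewrite !intrD; lra.
by rewrite intrD; ring.
Qed.

Lemma cf_complete_irrational x n : irrational x -> irrational (cf_complete x n).
Proof.
move=> xirr; elim: n => //= n IH.
by apply: irrationalV; rewrite -rmorphN; exact: irrationalDint.
Qed.

(* Farey orbits run through the values [c] and [c^-1], where [c > 1] is obtained
   from a complete quotient by subtracting an integer. *)
Variant cf_shift x (n : nat) c v : Prop := CfShift (m : int) of
  v = c \/ v = c^-1 & 1 < c & c <= cf_complete x n & cf_complete x n = c + m%:~R.

Lemma cf_shift_farey x n c v : irrational x -> cf_shift x n c v ->
  cf_shift x n (c - 1) (farey v) \/
  cf_shift x n.+1 (cf_complete x n.+1) (farey v).
Proof.
move=> xirr [m vE c1 cle cE].
have cirr : irrational c.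
  have -> : c = cf_complete x n + (- m)%:~R by rewrite cE rmorphN addrK.
  exact/irrationalDint/cf_complete_irrational.
(* Up to inversion a Farey step is [c - 1]; once this drops below 1, its inverse is the next
   complete quotient. *)
have fE : farey v = c - 1 \/ farey v = (c - 1)^-1.
  case: vE => ->; [left|right]; first by rewrite fareyR.
  rewrite fareyL ?invf_le1 ?ltW//; try lra.
  by field; apply/andP; split; apply/eqP; lra.
case: (ltgtP (c - 1) 1) => c2.
- right; have cE' : cf_complete x n.+1 = (c - 1)^-1.
    rewrite /= (_ : Num.floor _ = m + 1); first by rewrite cE intrD; congr _^-1; ring.
    by apply: floor_def; rewrite cE !intrD; lra.
  exists 0; rewrite ?addr0//.
  + by rewrite cE' invrK; case: fE; [right|left].
  + by rewrite cE' invf_gt1; lra.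
- left; exists (m + 1) => //; first by lra.
  by rewrite cE intrD; ring.
- by have := irrational_neq_int 2 cirr; rewrite (_ : c = 2%:~R) ?eqxx//; lra.
Qed.

Lemma cf_shift_next x n c v : irrational x -> cf_shift x n c v ->
  exists i c', cf_shift x n.+1 c' (iter i (@farey R) v).
Proof.
(* Induction on an integer bound for [c], which drops by 1 until the next quotient is reached. *)
move=> xirr; move: (Num.truncn c) (truncnS_gt c) => k.
elim: k c v => [|k IH] c v ck sh; first by case: sh => m _ c1; lra.
have [sh'|sh'] := cf_shift_farey xirr sh; last first.
  by exists 1%N, (cf_complete x n.+1).
have [|i [c' shi]] := IH _ _ _ sh'; first by move: ck; rewrite -[k.+2%:R]natr1; lra.
by exists i.+1, c'; rewrite iterSr.
Qed.

Lemma cf_shift_ge x N v : irrational x ->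
  (exists n c, (N <= n)%N /\ cf_shift x n c v) ->
  (exists n c, (N <= n)%N /\ cf_shift x n c (farey v)).
Proof.
move=> xirr [n [c [Nn /(cf_shift_farey xirr)[]]]] h.
  by exists n, (c - 1).
by exists n.+1, (cf_complete x n.+1); rewrite ltnW.
Qed.

Lemma cf_shift_init x : posirr x -> exists n c, cf_shift x n c x.
Proof.
move=> px; have [x0 _] := px; case: (ltP 1 x) => x1.
  by exists 0%N, x, 0; rewrite ?addr0//; left.
have {}x1 : x < 1 by case: (fareyP px) x1 => //; lra.
have f0 : Num.floor x = 0 by apply: floor_def; rewrite add0r; apply/andP; split; lra.
exists 1%N, x^-1, 0; rewrite /= ?f0 ?subr0 ?addr0//.
  by right; rewrite invrK.
by rewrite invf_gt1.
Qed.

Lemma eventually_bounded_cf x : posirr x ->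
  (exists N, forall n, (N <= n)%N -> cf_complete x n < 5) -> eventually_bounded x.
Proof.
move=> px [N cfN]; have xirr := px.2.
have [i hi] : exists i n c, (N <= n)%N /\ cf_shift x n c (iter i (@farey R) x).
  elim: N {cfN} => [|N [i [n [c [Nn sh]]]]].
    by have [n [c sh]] := cf_shift_init px; exists 0%N, n, c.
  have [j [c' sh']] := cf_shift_next xirr sh.
  by exists (j + i)%N, n.+1, c'; rewrite iterD.
exists i; split=> [|j]; first exact: iter_farey_posirr.
have {hi} : exists n c,
    (N <= n)%N /\ cf_shift x n c (iter j (@farey R) (iter i (@farey R) x)).
  by elim: j => //= j; exact: cf_shift_ge.
move: (iter j _ _) => v [n [c [/cfN c5 [m vE c1 cle _]]]].
case: vE => ->; first by apply/andP; split; lra.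
have c0 : 0 < c by lra.
have cV1 : c^-1 < 1 by rewrite invf_lt1.
by rewrite ltf_pV2 ?posrE//; apply/andP; split; lra.
Qed.

End ContinuedFraction.

Unset Implicit Arguments.

Theorem theorem7p6 (R : realType) (alpha : R) (alpha_irr : irrational alpha) :
  (5%:E <= ereal_sup [set B (2 ^+ k * alpha) | k in [set: nat]])%E.
Proof.
rewrite leNgt; apply/negP => sup5.
have cf5 k : exists N, forall n, (N <= n)%N -> cf_complete (2 ^+ k * alpha) n < 5.
  have : (B (2 ^+ k * alpha) < 5%:E)%E.
    by apply: le_lt_trans sup5; apply: ereal_sup_ubound; exists k.
  (* The limsup is an infimum of suprema over sets [V] containing a tail of the indices. *)
  move=> /ereal_inf_lt[_ [V [N _ NV] <-]] V5; exists N => n Nn.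
  have : ((partial_quotient (2 ^+ k * alpha) n)%:~R%:E < 5%:E :> \bar R)%E.
    apply: le_lt_trans V5; apply: ereal_sup_ubound; exists n => //.
    exact: NV.
  (* An integer floor below 5 is at most 4, so the complete quotient itself is below 5. *)
  rewrite lte_fin -[5]/(5%:~R) ltr_int /partial_quotient => h.
  have /andP[_ /lt_le_trans] := floor_itv (cf_complete (2 ^+ k * alpha) n).
  by apply; rewrite -[5]/(5%:~R) ler_int lezD1.
pose x := alpha - (Num.floor alpha)%:~R.
have xirr : irrational x by rewrite /x -rmorphN; exact: irrationalDint.
have px : posirr x.
  split=> //; rewrite lt_neqAle eq_sym (irrational_neq_int 0)//=.
  by rewrite subr_ge0 floor_le.
have ev k : eventually_bounded (2 ^+ k * x).
  apply: eventually_bounded_cf; first exact: posirr_exp2.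
  (* Index 0 is skipped because the integer shift changes the complete quotient there. *)
  have [N cfN] := cf5 k; exists N.+1 => -[//|n] Nn.
  rewrite -(cf_completeDint _ (2 ^+ k * Num.floor alpha)).
  rewrite (_ : _ + _ = 2 ^+ k * alpha); first by apply: cfN; lia.
  by rewrite rmorphM rmorphXn /x /=; ring.
apply: (not_disc17_doublings xirr) => k.
have pk := posirr_exp2 k px.
have [|n0 per] := eventually_periodic_window pk.
  by move=> j _; rewrite mulrA -exprD.
have [i w] := periodic_window_has (per n0 (leqnn _)).2.
rewrite -iterD in w.
apply: (@disc17_iter _ (i + n0)) => //.
have rt := periodic_root (per _ (leq_addl _ _)).1 w.
exists 2, (-3), (-1); split=> //.
rewrite -[RHS]rt; last first.
  by move=> n; rewrite -iterD; apply: (per _ _).2; lia.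
move: (iter _ _ _) => z; rewrite /form17 !rmorphN/=; ring.
Qed.
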